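(* Let $O$ be the origin of $\mathbb{R}^2$, and let $a>c>0$, $b=\sqrt{a^2-c^2}$. Suppose that $P=P(\theta)$ is a moving point in $\mathbb{R}^2$ satisfying, for $0\le\theta\le2\pi$, the following conditions: 1) for $\mathcal{D}=|\overrightarrow{OP}|$, $$\frac{d^2\mathcal{D}}{d\theta^2}=\frac{c^2(-a^2\cos^4\theta+b^2\sin^4\theta)}{(a^2\cos^2\theta+b^2\sin^2\theta)^{3/2}},\qquad \frac{d\mathcal{D}}{d\theta}\Big|_{\theta=0}=0,\qquad \mathcal{D}|_{\theta=0}=a;$$ 2) $$\frac{d\vec e_{\overrightarrow{OP}}}{d\theta}=\frac{ab\,(-b\sin\theta,a\cos\theta)}{(a^2\cos^2\theta+b^2\sin^2\theta)^{3/2}},\qquad \vec e_{\overrightarrow{OP}}|_{\theta=0}=(1,0).$$ Then the trajectory of $P$ is the ellipse $\vec r(\theta)=(a\cos\theta,b\sin\theta)$, $0\le\theta\le2\pi$; that is, $\overrightarrow{OP}(\theta)=(a\cos\theta,b\sin\theta)$ for all $\theta\in[0,2\pi]$.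
   Context: $\vec e_{\vec w}=\vec w/|\vec w|$ denotes the unit vector in the direction of a nonzero vector $\vec w$; it is implicit that $\overrightarrow{OP}(\theta)\neq\vec0$. *)

(* Defs.v *)
From Stdlib Require Import Reals.
From Coquelicot Require Import Coquelicot.
Open Scope R_scope.

(* Coquelicot's [norm] on [R * R] is the Euclidean norm, not the sup norm. *)
Definition unit_vec (w : R * R) : R * R := scal (/ norm w) w.

(* Coquelicot's [is_derive] with [locally x] replaced by its trace on [lo, hi]:
   two-sided at interior points, one-sided at the endpoints. *)
Definition is_derive_on {V : NormedModule R_AbsRing} (lo hi : R)
    (f : R -> V) (x : R) (l : V) : Prop :=
  filterdiff f (within (fun t : R => lo <= t <= hi) (locally x))
    (fun h : R => scal h l).

(* Main.v *)
(** The explicit parametrization satisfies the same initial value problems for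
    the radius and for the unit direction as [P] does, and a function on an
    interval is determined by its derivative and its initial value. So radius
    and direction agree with those of the ellipse, and [P] is their product. *)

Require Import Defs.
From Stdlib Require Import Reals Lra.
From Coquelicot Require Import Coquelicot.
Open Scope R_scope.

(** * Derivatives relative to a closed interval, and uniqueness of primitives *)

Lemma within_interval_proper (lo hi x : R) :
  lo <= x <= hi ->
  ProperFilter (within (fun t : R => lo <= t <= hi) (locally x)).
Proof.
intros Hx; constructor; [|apply within_filter, locally_filter].
intros Q HQ; exists x; apply (locally_singleton _ _ HQ), Hx.
Qed.

Lemma is_filter_lim_within_locally (D : R -> Prop) (x : R) :
  is_filter_lim (within D (locally x)) x.
Proof.
intros Q HQ; unfold within.
now apply filter_imp with (2 := HQ); intros.
Qed.

Lemma is_derive_on_of_is_derive {V : NormedModule R_AbsRing} (lo hi : R)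
    (f : R -> V) (x : R) (l : V) :
  lo <= x <= hi -> is_derive f x l -> is_derive_on lo hi f x l.
Proof.
intros Hx Hf; unfold is_derive_on.
apply (@filterdiff_locally R_AbsRing R_NormedModule V _
  (within_interval_proper _ _ _ Hx) f x); [|exact Hf].
apply is_filter_lim_within_locally.
Qed.

Lemma is_derive_on_minus {V : NormedModule R_AbsRing} (lo hi : R)
    (f g : R -> V) (x : R) (l m : V) :
  is_derive_on lo hi f x l -> is_derive_on lo hi g x m ->
  is_derive_on lo hi (fun t => minus (f t) (g t)) x (minus l m).
Proof.
intros Hf Hg; unfold is_derive_on.
eapply filterdiff_ext_lin; [exact (filterdiff_minus_fct _ _ _ _ Hf Hg)|].
intros h; simpl; symmetry; exact (scal_minus_distr_l h l m).
Qed.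

Lemma is_derive_on_linear {V W : NormedModule R_AbsRing} (lo hi : R)
    (g : V -> W) (f : R -> V) (x : R) (l : V) :
  is_linear g -> is_derive_on lo hi f x l ->
  is_derive_on lo hi (fun t => g (f t)) x (g l).
Proof.
intros Hg Hf; unfold is_derive_on.
eapply filterdiff_ext_lin.
- exact (filterdiff_comp _ _ _ _ Hf (filterdiff_linear g Hg)).
- intros h; exact (linear_scal g Hg h l).
Qed.

(* Precomposing with the retraction of the line onto [lo, hi] turns a vanishing
   one-sided derivative into a two-sided one, because the retraction is
   1-Lipschitz. *)
Lemma is_derive_clamp_0 (lo hi : R) (f : R -> R) (x : R) :
  lo <= x <= hi -> is_derive_on lo hi f x 0 ->
  is_derive (fun t => f (Rmax lo (Rmin t hi))) x 0.
Proof.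
intros Hx [_ Hd].
assert (Hxx : Rmax lo (Rmin x hi) = x).
{ rewrite Rmin_left, Rmax_right; lra. }
split; [apply is_linear_scal_l|].
intros y Hy.
(* [filterdiff] quantifies over every limit [y] of the filter; here only [x] is one. *)
rewrite <- (is_filter_lim_locally_unique (V := R_NormedModule) _ _ Hy).
intros eps.
destruct (Hd x (is_filter_lim_within_locally _ _) eps) as [d Hball].
exists d; intros t Ht; rewrite Hxx.
assert (Hclamp : lo <= Rmax lo (Rmin t hi) <= hi /\
  Rabs (Rmax lo (Rmin t hi) - x) <= Rabs (t - x)).
{ unfold Rmax, Rmin, Rabs; repeat destruct Rle_dec; repeat destruct Rcase_abs;
  lra. }
destruct Hclamp as [Hin Hlip].
specialize (Hball (Rmax lo (Rmin t hi)) (Rle_lt_trans _ _ _ Hlip Ht) Hin).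
change (Rabs (f (Rmax lo (Rmin t hi)) - f x - (Rmax lo (Rmin t hi) - x) * 0)
  <= eps * Rabs (Rmax lo (Rmin t hi) - x)) in Hball.
change (Rabs (f (Rmax lo (Rmin t hi)) - f x - (t - x) * 0)
  <= eps * Rabs (t - x)).
(* The linear term is zero on both sides, so it does not matter that [t] and its clamped value have
   different displacements from [x]. *)
rewrite Rmult_0_r in Hball |- *.
apply Rle_trans with (1 := Hball).
apply Rmult_le_compat_l; [apply Rlt_le, cond_pos | exact Hlip].
Qed.

(** The mean value theorem needs two-sided continuity at the endpoints, so it is applied to the
    clamped extension of [f], which agrees with [f] on the interval. *)
Lemma is_derive_on_0_constant (lo hi : R) (f : R -> R) :
  (forall x, lo <= x <= hi -> is_derive_on lo hi f x 0) ->
  forall x, lo <= x <= hi -> f x = f lo.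
Proof.
intros Hf x Hx.
set (g := fun t => f (Rmax lo (Rmin t hi))).
assert (Hg : forall t, lo <= t <= hi -> is_derive g t 0).
{ intros t Ht; apply is_derive_clamp_0; auto. }
destruct (MVT_gen g lo x (fun _ => 0)) as [z [_ Hz]].
- rewrite Rmin_left, Rmax_right by lra; intros t Ht; apply Hg; lra.
- rewrite Rmin_left, Rmax_right by lra; intros t Ht.
  apply continuity_pt_filterlim, (ex_derive_continuous g t).
  exists 0; apply Hg; lra.
- unfold g in Hz.
  rewrite (Rmin_left x), (Rmin_left lo), 2!Rmax_right in Hz by lra; lra.
Qed.

(** Here [f] is the unknown function, differentiable only relative to the interval, and [g] is the
    explicit solution; their difference has derivative zero. *)
Lemma eq_of_is_derive_on (lo hi : R) (f g df : R -> R) :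
  (forall x, lo <= x <= hi -> is_derive_on lo hi f x (df x)) ->
  (forall x, lo <= x <= hi -> is_derive g x (df x)) ->
  f lo = g lo ->
  forall x, lo <= x <= hi -> f x = g x.
Proof.
intros Hf Hg H0 x Hx.
assert (H : f x - g x = f lo - g lo); [|lra].
apply (is_derive_on_0_constant lo hi (fun t => f t - g t)); [|exact Hx].
intros t Ht.
rewrite <- (Rminus_diag (df t)).
apply (is_derive_on_minus (V := R_NormedModule)); auto.
apply is_derive_on_of_is_derive; auto.
Qed.

Lemma Rpower_3_2 (x : R) : 0 < x -> Rpower x (3 / 2) = x * sqrt x.
Proof.
intros Hx.
replace (3 / 2) with (1 + / 2) by field.
now rewrite Rpower_plus, Rpower_1, Rpower_sqrt.
Qed.

Lemma norm_scal_unit_vec (w : R * R) :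
  w <> (0, 0) -> scal (norm w) (unit_vec w) = w.
Proof.
intros Hw; unfold unit_vec.
rewrite scal_assoc.
replace (mult (norm w) (/ norm w)) with (one : R); [apply (scal_one w)|].
symmetry; apply Rinv_r; intros H0; apply Hw, (norm_eq_zero w H0).
Qed.

(** * Polar radius and direction of the ellipse, and their derivatives *)

Definition ellipse_radius (a b t : R) : R :=
  sqrt (a ^ 2 * cos t ^ 2 + b ^ 2 * sin t ^ 2).

Section EllipseDerivatives.

Variables a b : R.
Hypotheses (Ha : 0 < a) (Hb : 0 < b).

Lemma ellipse_radius_sqr_pos (t : R) :
  0 < a ^ 2 * cos t ^ 2 + b ^ 2 * sin t ^ 2.
Proof.
assert (Ht : cos t ^ 2 = 1 - sin t ^ 2).
{ generalize (sin2_cos2 t); unfold Rsqr; lra. }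
destruct (Req_dec (sin t) 0) as [Hs | Hs].
- rewrite Ht, Hs; generalize (pow_lt a 2 Ha); lra.
- assert (0 < (b * sin t) ^ 2) by (apply pow2_gt_0; nra).
  generalize (pow2_ge_0 (a * cos t)); nra.
Qed.

Lemma ellipse_radius_pos (t : R) : 0 < ellipse_radius a b t.
Proof. apply sqrt_lt_R0, ellipse_radius_sqr_pos. Qed.

Lemma ellipse_radius_sqr (t : R) :
  ellipse_radius a b t ^ 2 = a ^ 2 * cos t ^ 2 + b ^ 2 * sin t ^ 2.
Proof. apply pow2_sqrt, Rlt_le, ellipse_radius_sqr_pos. Qed.

(** Turns the denominators of the differential equations into powers of the radius, so that [field]
    can handle them. *)
Lemma ellipse_radius_cube (t : R) :
  Rpower (a ^ 2 * cos t ^ 2 + b ^ 2 * sin t ^ 2) (3 / 2)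
  = ellipse_radius a b t ^ 3.
Proof.
rewrite Rpower_3_2 by apply ellipse_radius_sqr_pos.
rewrite <- ellipse_radius_sqr at 1; unfold ellipse_radius; ring.
Qed.

Lemma ellipse_radius_0 : ellipse_radius a b 0 = a.
Proof.
unfold ellipse_radius; rewrite cos_0, sin_0.
replace (a ^ 2 * 1 ^ 2 + b ^ 2 * 0 ^ 2) with (a ^ 2) by ring.
apply sqrt_pow2; lra.
Qed.

Lemma is_derive_ellipse_radius (t : R) :
  is_derive (ellipse_radius a b) t
    (- (a ^ 2 - b ^ 2) * (sin t * cos t) / ellipse_radius a b t).
Proof.
generalize (ellipse_radius_pos t) (ellipse_radius_sqr_pos t); intros Hr Hq.
unfold ellipse_radius at 1; auto_derive.
- ring_simplify; ring_simplify in Hq; exact Hq.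
(* [auto_derive] has unfolded the squares; restoring them lets [fold] recognise the radius. *)
- change (cos t * (cos t * 1)) with (cos t ^ 2);
  change (sin t * (sin t * 1)) with (sin t ^ 2).
  change (a * (a * 1)) with (a ^ 2); change (b * (b * 1)) with (b ^ 2).
  fold (ellipse_radius a b t); field; lra.
Qed.

Lemma Derive_ellipse_radius (t : R) :
  Derive (fun u : R => ellipse_radius a b u) t
  = - (a ^ 2 - b ^ 2) * (sin t * cos t) / ellipse_radius a b t.
Proof. exact (is_derive_unique _ _ _ (is_derive_ellipse_radius t)). Qed.

Lemma is_derive_ellipse_radius_derivative (t : R) :
  is_derive
    (fun u => - (a ^ 2 - b ^ 2) * (sin u * cos u) / ellipse_radius a b u) t
    ((a ^ 2 - b ^ 2) * (- a ^ 2 * cos t ^ 4 + b ^ 2 * sin t ^ 4)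
     / ellipse_radius a b t ^ 3).
Proof.
generalize (ellipse_radius_pos t) (is_derive_ellipse_radius t) (ellipse_radius_sqr t).
intros Hr Hd Hs.
auto_derive.
- repeat split; [eexists; exact Hd | lra].
- rewrite Derive_ellipse_radius.
  (* The quotient rule is put over the cube of the radius. Once the squared radius is expanded, the
     mixed terms in [sin t ^ 2 * cos t ^ 2] cancel. *)
  transitivity ((- (a ^ 2 - b ^ 2) * ((cos t ^ 2 - sin t ^ 2) * ellipse_radius a b t ^ 2
    + (a ^ 2 - b ^ 2) * sin t ^ 2 * cos t ^ 2))
    / ellipse_radius a b t ^ 3); [field; lra|].
  rewrite Hs; field; lra.
Qed.

Lemma is_derive_ellipse_direction_fst (t : R) :
  is_derive (fun u => a * cos u / ellipse_radius a b u) t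
    (a * b / ellipse_radius a b t ^ 3 * (- b * sin t)).
Proof.
generalize (ellipse_radius_pos t) (is_derive_ellipse_radius t) (ellipse_radius_sqr t).
intros Hr Hd Hs.
assert (Hsc : sin t ^ 2 + cos t ^ 2 = 1).
{ generalize (sin2_cos2 t); unfold Rsqr; lra. }
auto_derive.
- repeat split; [eexists; exact Hd | lra].
- rewrite Derive_ellipse_radius.
  transitivity ((a * sin t * ((a ^ 2 - b ^ 2) * cos t ^ 2 - ellipse_radius a b t ^ 2))
    / ellipse_radius a b t ^ 3); [field; lra|].
  rewrite Hs.
  (* Inserting the factor [sin t ^ 2 + cos t ^ 2] makes both numerators cubic in sine and cosine, so
     they agree as polynomials. *)
  replace (a * b / ellipse_radius a b t ^ 3 * (- b * sin t)) with
    (- a * b ^ 2 * sin t * (sin t ^ 2 + cos t ^ 2) / ellipse_radius a b t ^ 3)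
    by (rewrite Hsc; field; lra).
  field; lra.
Qed.

Lemma is_derive_ellipse_direction_snd (t : R) :
  is_derive (fun u => b * sin u / ellipse_radius a b u) t
    (a * b / ellipse_radius a b t ^ 3 * (a * cos t)).
Proof.
generalize (ellipse_radius_pos t) (is_derive_ellipse_radius t) (ellipse_radius_sqr t).
intros Hr Hd Hs.
assert (Hsc : sin t ^ 2 + cos t ^ 2 = 1).
{ generalize (sin2_cos2 t); unfold Rsqr; lra. }
auto_derive.
- repeat split; [eexists; exact Hd | lra].
- rewrite Derive_ellipse_radius.
  transitivity ((b * cos t * ((a ^ 2 - b ^ 2) * sin t ^ 2 + ellipse_radius a b t ^ 2))
    / ellipse_radius a b t ^ 3); [field; lra|].
  rewrite Hs.
  replace (a * b / ellipse_radius a b t ^ 3 * (a * cos t)) with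
    (a ^ 2 * b * cos t * (sin t ^ 2 + cos t ^ 2) / ellipse_radius a b t ^ 3)
    by (rewrite Hsc; field; lra).
  field; lra.
Qed.

End EllipseDerivatives.

Theorem theorem5p2 (a b c : R) (Hc : 0 < c) (Hca : c < a)
  (Hb : b = sqrt (a ^ 2 - c ^ 2))
  (P : R -> R * R)
  (HP : forall theta : R, 0 <= theta <= 2 * PI -> P theta <> (0, 0))
  (dD : R -> R)
  (HdD : forall theta : R, 0 <= theta <= 2 * PI ->
    is_derive_on 0 (2 * PI) (fun t : R => norm (P t)) theta (dD theta))
  (HddD : forall theta : R, 0 <= theta <= 2 * PI ->
    is_derive_on 0 (2 * PI) dD theta
      (c ^ 2 * (- a ^ 2 * cos theta ^ 4 + b ^ 2 * sin theta ^ 4)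
       / Rpower (a ^ 2 * cos theta ^ 2 + b ^ 2 * sin theta ^ 2) (3 / 2)))
  (HdD0 : dD 0 = 0)
  (HD0 : norm (P 0) = a)
  (Hde : forall theta : R, 0 <= theta <= 2 * PI ->
    is_derive_on 0 (2 * PI) (fun t : R => unit_vec (P t)) theta
      (scal (a * b / Rpower (a ^ 2 * cos theta ^ 2 + b ^ 2 * sin theta ^ 2) (3 / 2))
         (- b * sin theta, a * cos theta)))
  (He0 : unit_vec (P 0) = (1, 0)) :
  forall theta : R, 0 <= theta <= 2 * PI ->
    P theta = (a * cos theta, b * sin theta).
Proof.
assert (Ha : 0 < a) by lra.
assert (Hb0 : 0 < b) by (rewrite Hb; apply sqrt_lt_R0; nra).
(* This relation matches the coefficient [c ^ 2] of the radial equation with the one computed for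
   the ellipse. *)
assert (Hcab : c ^ 2 = a ^ 2 - b ^ 2).
{ rewrite Hb, pow2_sqrt by nra; ring. }
(* The radial equation has order two, so uniqueness is used twice: for [dD], then for the radius
   itself. *)
assert (HdDeq : forall t, 0 <= t <= 2 * PI ->
  dD t = - (a ^ 2 - b ^ 2) * (sin t * cos t) / ellipse_radius a b t).
{ apply (eq_of_is_derive_on 0 (2 * PI) dD _ _ HddD).
  - intros t _; rewrite ellipse_radius_cube, Hcab by assumption.
    now apply is_derive_ellipse_radius_derivative.
  - rewrite HdD0, sin_0, ellipse_radius_0 by assumption; field; lra. }
assert (HDeq : forall t, 0 <= t <= 2 * PI -> norm (P t) = ellipse_radius a b t).
{ apply (eq_of_is_derive_on 0 (2 * PI) (fun t => norm (P t)) _ _ HdD).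
  - intros t Ht; rewrite HdDeq by exact Ht.
    now apply is_derive_ellipse_radius.
  - now rewrite HD0, ellipse_radius_0. }
(* Uniqueness is available for real-valued functions only; the linear projections carry the vector
   equation to each coordinate. *)
assert (Hfst : forall t, 0 <= t <= 2 * PI ->
  fst (unit_vec (P t)) = a * cos t / ellipse_radius a b t).
{ apply (eq_of_is_derive_on 0 (2 * PI) (fun t => fst (unit_vec (P t))) _ _
    (fun t Ht => is_derive_on_linear _ _ _ _ _ _ is_linear_fst (Hde t Ht))).
  - intros t _; rewrite ellipse_radius_cube by assumption.
    now apply is_derive_ellipse_direction_fst.
  - rewrite He0, ellipse_radius_0, cos_0 by assumption; simpl; field; lra. }
assert (Hsnd : forall t, 0 <= t <= 2 * PI ->
  snd (unit_vec (P t)) = b * sin t / ellipse_radius a b t).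
{ apply (eq_of_is_derive_on 0 (2 * PI) (fun t => snd (unit_vec (P t))) _ _
    (fun t Ht => is_derive_on_linear _ _ _ _ _ _ is_linear_snd (Hde t Ht))).
  - intros t _; rewrite ellipse_radius_cube by assumption.
    now apply is_derive_ellipse_direction_snd.
  - rewrite He0, ellipse_radius_0, sin_0 by assumption; simpl; field; lra. }
intros t Ht.
generalize (ellipse_radius_pos a b Ha Hb0 t); intros Hr.
(* Since [P t] is nonzero, it is its norm times its direction; the radius then cancels the
   denominators of the direction. *)
rewrite <- (norm_scal_unit_vec (P t) (HP t Ht)).
rewrite HDeq, (surjective_pairing (unit_vec (P t))), Hfst, Hsnd by exact Ht.
apply injective_projections; cbn; unfold mult; simpl; field; lra.
Qed.
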